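(* Consider the one-dimensional shallow water equations $W_t+F(W)_x=G(x,W)$ with bottom function $b$. The upwind time splitting scheme Q-tra2 defined in the context satisfies the Exact C-property: it is exact when applied to the stationary Problem SP (water at rest: $q=0$, $h=H(x)$, $b(x)+H(x)=A$ constant). That is, if $H>0$, $b=A-H$, and $W_j^n=(H(x_j),0)^T$ for all $j$, then one time step of Q-tra2 gives $W_j^{n+1}=(H(x_j),0)^T$ for all $j$.
   Context: **Equations.** Let $g>0$ be the gravitational constant and $b:\mathbb{R}\to\mathbb{R}$ the bottom function. The unknown is $W=(h,q)^T$ with water height $h>0$ and flow per unit length $q$, and $$F(W)=\begin{pmatrix} q\\ \frac{q^2}{h}+\frac12 g h^2\end{pmatrix},\qquad G(x,W)=\begin{pmatrix}0\\ -g h b'(x)\end{pmatrix}.$$ The Jacobian of $F$ is $A(W)=\begin{pmatrix}0&1\\ -\frac{q^2}{h^2}+gh & \frac{2q}{h}\end{pmatrix}=X\Lambda X^{-1}$ with $\Lambda=\mathrm{diag}(\lambda_1,\lambda_2)$, $\lambda_1=\frac qh+\sqrt{gh}$, $\lambda_2=\frac qh-\sqrt{gh}$, $X=\begin{pmatrix}1&1\\ \lambda_1&\lambda_2\end{pmatrix}$. Write $|A(W)|=X|\Lambda|X^{-1}$ with $|\Lambda|=\mathrm{diag}(|\lambda_1|,|\lambda_2|)$. **Grid.** Uniform space step $\Delta x>0$, nodes $x_j$ with $x_{j+1}-x_j=\Delta x$ ($j\in\mathbb{Z}$), time step $\Delta t=t^{n+1}-t^n>0$, and $b_j=b(x_j)$.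 $W_j^n=(h_j^n,q_j^n)^T$ denotes the discrete solution at $(x_j,t^n)$. **Scheme Q-tra2.** One time step $W^n\mapsto W^{n+1}$ is as follows. 1. (Homogeneous step, Q-scheme of van Leer.) With $$F_{j+1/2}=\frac{F(W_j^n)+F(W_{j+1}^n)}{2}-\frac12\left|A\!\left(\frac{W_j^n+W_{j+1}^n}{2}\right)\right|(W_{j+1}^n-W_j^n),$$ set $\widehat W_j^{n+1}=W_j^n-\frac{\Delta t}{\Delta x}\left(F_{j+1/2}-F_{j-1/2}\right)$. 2. (Upwinded source step.) Let $\overline W_{L_j}=\frac{W_j^n+W_{j-1}^n}{2}$, $\overline W_{R_j}=\frac{W_{j+1}^n+W_j^n}{2}$, and $$D_L=I+|A(\overline W_{L_j})|\,A(\overline W_{L_j})^{-1},\qquad D_R=I-|A(\overline W_{R_j})|\,A(\overline W_{R_j})^{-1}$$ (where the Jacobians are invertible, as is the case for Problem SP). On $[t^n,t^{n+1}]$, solve the ODEs $\frac{d}{dt}W=D_L\,G$ and $\frac{d}{dt}W=D_R\,G$, both with initial value $\widehat W_j^{n+1}$, where $G=(0,-g h b')^T$ is discretized by the constants $h=\frac{h_j^n+h_{j-1}^n}{2}$, $b'=\frac{b_j-b_{j-1}}{\Delta x}$ in the left ODE and $h=\frac{h_{j+1}^n+h_j^n}{2}$, $b'=\frac{b_{j+1}-b_j}{\Delta x}$ in the right ODE. This gives $$W_{L_j}^{n+1}=\widehat W_j^{n+1}+\Delta t\,D_L\begin{pmatrix}0\\ -g\,\frac{h_j^n+h_{j-1}^n}{2}\,\frac{b_j-b_{j-1}}{\Delta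 x}\end{pmatrix},\qquad W_{R_j}^{n+1}=\widehat W_j^{n+1}+\Delta t\,D_R\begin{pmatrix}0\\ -g\,\frac{h_{j+1}^n+h_j^n}{2}\,\frac{b_{j+1}-b_j}{\Delta x}\end{pmatrix}.$$ 3. Set $W_j^{n+1}=\frac12\left(W_{L_j}^{n+1}+W_{R_j}^{n+1}\right)$. **Problem SP.** The stationary problem representing water at rest: $q(x,t)=0$, $h(x,t)=H(x)$, with $b(x)+H(x)=A$ for a constant $A$. **Exact C-property.** A scheme satisfies the Exact C-property if it is exact when applied to Problem SP. *)

(* Defs.v *)
From HB Require Import structures.
From mathcomp Require Import all_boot all_order all_algebra.
From mathcomp Require Import all_classical all_reals all_analysis.

Set Implicit Arguments.
Unset Strict Implicit.
Unset Printing Implicit Defensive.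

Import Order.TTheory GRing.Theory Num.Theory.
Import numFieldNormedType.Exports.

Local Open Scope classical_set_scope.
Local Open Scope ring_scope.

Section ShallowWater.
Variable R : realType.

Definition vec2 (a b : R) : 'cV[R]_2 :=
  \col_(i < 2) (if i == 0 then a else b).

Definition mat2 (a b c d : R) : 'M[R]_2 :=
  \matrix_(i < 2, j < 2)
    (if i == 0 then if j == 0 then a else b else if j == 0 then c else d).

Definition height (W : 'cV[R]_2) : R := W 0 0.
Definition flow (W : 'cV[R]_2) : R := W 1 0.

Variable g : R.

Definition flux (W : 'cV[R]_2) : 'cV[R]_2 :=
  let h := height W in let q := flow W in
  vec2 q (q ^+ 2 / h + 2^-1 * g * h ^+ 2).

(* The source depends on W only through the height [h], and on x only through
   the slope [db] of the bottom. *)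
Definition source (h db : R) : 'cV[R]_2 := vec2 0 (- (g * h * db)).

Definition jacobian_flux (W : 'cV[R]_2) : 'M[R]_2 :=
  let h := height W in let q := flow W in
  mat2 0 1 (- (q ^+ 2 / h ^+ 2) + g * h) (2 * q / h).

Definition lambda1 (W : 'cV[R]_2) : R :=
  flow W / height W + Num.sqrt (g * height W).
Definition lambda2 (W : 'cV[R]_2) : R :=
  flow W / height W - Num.sqrt (g * height W).

Definition eigenvectors (W : 'cV[R]_2) : 'M[R]_2 :=
  mat2 1 1 (lambda1 W) (lambda2 W).

(* |A(W)| = X |Lambda| X^-1; X is invertible as soon as g * h > 0. *)
Definition abs_jacobian (W : 'cV[R]_2) : 'M[R]_2 :=
  eigenvectors W *m mat2 `|lambda1 W| 0 0 `|lambda2 W|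
    *m invmx (eigenvectors W).

Definition mean (W W' : 'cV[R]_2) : 'cV[R]_2 := 2^-1 *: (W + W').

(* F_{j+1/2} as a function of W_j (left) and W_{j+1} (right). *)
Definition numerical_flux (Wl Wr : 'cV[R]_2) : 'cV[R]_2 :=
  mean (flux Wl) (flux Wr)
    - 2^-1 *: (abs_jacobian (mean Wl Wr) *m (Wr - Wl)).

Definition homogeneous_step (dx dt : R) (W : int -> 'cV[R]_2) (j : int)
    : 'cV[R]_2 :=
  W j - (dt / dx) *:
    (numerical_flux (W j) (W (j + 1)) - numerical_flux (W (j - 1)) (W j)).

Definition D_left (Wbar : 'cV[R]_2) : 'M[R]_2 :=
  1%:M + abs_jacobian Wbar *m invmx (jacobian_flux Wbar).
Definition D_right (Wbar : 'cV[R]_2) : 'M[R]_2 :=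
  1%:M - abs_jacobian Wbar *m invmx (jacobian_flux Wbar).

(* [w1] is the value at time [t1] of a solution of dW/dt = v on [t0, t1] with
   initial value [w0]; the discretized right-hand sides are constant in time. *)
Definition ode_step (v : 'cV[R]_2) (t0 t1 : R) (w0 w1 : 'cV[R]_2) : Prop :=
  exists W : R -> 'cV[R]_2,
    [/\ {within `[t0, t1], continuous W},
        forall t, t \in `]t0, t1[ -> is_derive t 1 W v,
        W t0 = w0
      & W t1 = w1].

(* A one-step scheme relates the bottom, the nodes, the space step, t^n,
   t^{n+1}, W^n and W^{n+1}. *)
Definition scheme := (R -> R) -> (int -> R) -> R -> R -> R ->
  (int -> 'cV[R]_2) -> (int -> 'cV[R]_2) -> Prop.

(* A step is only defined from a state with positive heights and invertible
   Jacobians at the interface averages. *)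
Definition Qtra2 : scheme := fun b x dx t0 t1 W W' =>
  [/\ forall j, 0 < height (W j),
      forall j, jacobian_flux (mean (W j) (W (j + 1))) \in unitmx
    & forall j, exists WL WR : 'cV[R]_2,
      let What := homogeneous_step dx (t1 - t0) W j in
      [/\ ode_step
            (D_left (mean (W j) (W (j - 1))) *m
               source ((height (W j) + height (W (j - 1))) / 2)
                      ((b (x j) - b (x (j - 1))) / dx))
            t0 t1 What WL,
          ode_step
            (D_right (mean (W (j + 1)) (W j)) *m
               source ((height (W (j + 1)) + height (W j)) / 2)
                      ((b (x (j + 1)) - b (x j)) / dx))
            t0 t1 What WR
        & W' j = 2^-1 *: (WL + WR)]].

Definition problem_SP (b : R -> R) (W : R -> R -> 'cV[R]_2) : Prop :=
  exists (H : R -> R) (A : R),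
    [/\ forall x, 0 < H x,
        forall x, b x + H x = A
      & forall x t, W x t = vec2 (H x) 0].

(* The equivalence says both that a step from the exact values is possible and
   that its only outcome is the exact values at the next time. *)
Definition exact_C_property (S : scheme) : Prop :=
  forall (b : R -> R) (W : R -> R -> 'cV[R]_2), problem_SP b W ->
  forall (x : int -> R) (dx : R), 0 < dx -> (forall j, x (j + 1) - x j = dx) ->
  forall t0 t1 : R, t0 < t1 ->
  forall Wn Wn1 : int -> 'cV[R]_2, (forall j, Wn j = W (x j) t0) ->
  S b x dx t0 t1 Wn Wn1 <-> (forall j, Wn1 j = W (x j) t1).

End ShallowWater.

(* Main.v *)
Require Import Defs.
From mathcomp Require Import all_boot all_order all_algebra.
From mathcomp Require Import ring lra.
From mathcomp Require Import all_classical all_reals all_analysis.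

(** Why the scheme preserves water at rest.

    When q = 0 the Jacobian at an interface of mean height m is
    A = [[0, 1], [c^2, 0]] with c = sqrt (g m).  Its eigenvalues are c and -c,
    which have the same absolute value, so |A| = c I
    ([abs_jacobian_rest]) and |A| A^-1 = [[0, 1/c], [c, 0]]
    ([abs_sign_rest]).  The viscosity of the numerical flux thus only acts on
    the height equation, where it adds - c (h_r - h_l) / 2, and the upwinded
    source puts a term in the height equation although the source itself has
    none there.

    Since b + H is constant, the slope of the bottom is minus the slope of the
    height.  In the height equation the numerical viscosity at each interface
    is then cancelled by the term that the upwinding of the source creates at
    the same interface.  In the flow equation the source terms are,
    up to the factor 1/dx, g/2 (h_l + h_r) (h_r - h_l) = g/2 (h_r^2 - h_l^2),
    which is the jump of the pressure g h^2 / 2 across the interface: taking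
    the source at the arithmetic mean of the heights is what makes this exact
    ([rest_balance]).

    The scheme is a relation, because each source substep asks for a solution
    of an ODE.  The right-hand side is a constant vector, so the mean value
    theorem applied to each entry shows that the only possible outcome is the
    affine one ([ode_stepE]); hence the step is both possible and
    deterministic. *)

Set Implicit Arguments.
Unset Strict Implicit.
Unset Printing Implicit Defensive.

Import Order.TTheory GRing.Theory Num.Theory.
Import numFieldNormedType.Exports.

Local Open Scope classical_set_scope.
Local Open Scope ring_scope.

(** * Differential equations with a constant right-hand side *)

Section ConstantODE.
Variable R : realType.

Lemma is_derive_entry m n (W : R -> 'M[R]_(m.+1, n.+1))
    (v : 'M[R]_(m.+1, n.+1)) (t : R) i j :
  is_derive t 1 W v -> is_derive t 1 (fun s => W s i j) (v i j).
Proof.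
move=> [dW Wv]; apply: DeriveDef; first by move/derivable_mxP : dW; apply.
by rewrite -Wv derive_mx// mxE.
Qed.

Lemma is_derive_affine (V : normedModType R) (w v : V) (t0 t : R) :
  is_derive t 1 (fun s : R => w + (s - t0) *: v) v.
Proof.
have lin : is_derive t 1 ( *:%R ^~ v : R -> V) v.
  apply: DeriveDef; first exact/derivable1_diffP.
  by rewrite deriveE// diff_val/= scale1r.
have -> : (fun s : R => w + (s - t0) *: v) =
    cst (w - t0 *: v) + ( *:%R ^~ v : R -> V).
  by apply/funext => s /=; rewrite scalerBl addrCA addrC.
by apply: is_derive_eq (add0r v).
Qed.

(** An entry of a solution has a constant derivative on the open interval and
    is continuous on the closed one, so the mean value theorem fixes its
    increment.  It is applied entrywise because it has no vector-valued
    version with equality. *)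
Lemma ode_stepE (v w0 w1 : 'cV[R]_2) (t0 t1 : R) : t0 < t1 ->
  ode_step v t0 t1 w0 w1 <-> w1 = w0 + (t1 - t0) *: v.
Proof.
move=> t01; split=> [[W [Wc Wd <- <-]]|->].
  apply/matrixP => i j; rewrite !mxE.
  have Wijc : {within `[t0, t1], continuous (fun t => W t i j)}.
    move=> x; apply: (@continuous_comp _ _ _ (W : subspace _ -> _)
      (fun M : 'cV[R]_2 => M i j)); first exact: Wc.
    exact: coord_continuous.
  have dWij t : t \in `]t0, t1[ -> is_derive t 1 (fun t => W t i j) (v i j).
    by move=> /Wd; exact: is_derive_entry.
  by have [c _] := MVT t01 dWij Wijc; lra.
exists (fun t => w0 + (t - t0) *: v); split => //.
- apply: continuous_subspaceT => t.
  apply/differentiable_continuous/derivable1_diffP.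
  by have [] := is_derive_affine w0 v t0 t.
- by move=> t _; exact: is_derive_affine.
- by rewrite subrr scale0r addr0.
Qed.

End ConstantODE.

(** * Calculus of explicit matrices of size two *)

Section TwoByTwo.
Variable R : realType.
Implicit Types a b c d : R.

Lemma add_vec2 a b c d : vec2 a b + vec2 c d = vec2 (a + c) (b + d).
Proof. by apply/matrixP => i j; rewrite !mxE; case: ifP. Qed.

Lemma opp_vec2 a b : - vec2 a b = vec2 (- a) (- b).
Proof. by apply/matrixP => i j; rewrite !mxE; case: ifP. Qed.

Lemma scale_vec2 k a b : k *: vec2 a b = vec2 (k * a) (k * b).
Proof. by apply/matrixP => i j; rewrite !mxE; case: ifP. Qed.

Lemma add_mat2 a b c d a' b' c' d' :
  mat2 a b c d + mat2 a' b' c' d' = mat2 (a + a') (b + b') (c + c') (d + d').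
Proof. by apply/matrixP => i j; rewrite !mxE; case: ifP; case: ifP. Qed.

Lemma opp_mat2 a b c d : - mat2 a b c d = mat2 (- a) (- b) (- c) (- d).
Proof. by apply/matrixP => i j; rewrite !mxE; case: ifP; case: ifP. Qed.

Lemma mul_mat2 a b c d a' b' c' d' :
  mat2 a b c d *m mat2 a' b' c' d' =
  mat2 (a * a' + b * c') (a * b' + b * d') (c * a' + d * c') (c * b' + d * d').
Proof.
apply/matrixP => i j; rewrite !mxE !big_ord_recl big_ord0 !mxE /= addr0.
by case: ifP; case: ifP.
Qed.

Lemma mul_mat2_vec2 a b c d x y :
  mat2 a b c d *m vec2 x y = vec2 (a * x + b * y) (c * x + d * y).
Proof.
apply/matrixP => i j; rewrite !mxE !big_ord_recl big_ord0 !mxE /= addr0.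
by case: ifP.
Qed.

Lemma scalar_mat2 a : a%:M = mat2 a 0 0 a.
Proof.
apply/matrixP => i j; rewrite !mxE.
by case: i j => [[|[|//]] ?] [[|[|//]] ?].
Qed.

Lemma det_mat2 a b c d : \det (mat2 a b c d) = a * d - b * c.
Proof.
rewrite (expand_det_row _ 0) !big_ord_recl big_ord0 /cofactor !det_mx11 !mxE /=.
by ring.
Qed.

Lemma invmx_mat2_adiag a b : a != 0 -> b != 0 ->
  invmx (mat2 0 a b 0) = mat2 0 b^-1 a^-1 0.
Proof.
move=> a0 b0; rewrite -[RHS]mul1mx -(@mulVmx _ _ (mat2 0 a b 0)).
  rewrite -mulmxA mul_mat2 !mul0r !mulr0 !addr0 !add0r !divff//.
  by rewrite -scalar_mat2 mulmx1.
by rewrite unitmxE det_mat2 unitfE mul0r sub0r oppr_eq0 mulf_neq0.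
Qed.

End TwoByTwo.

(** * One step of the scheme from a state at rest *)

Section AtRest.
Variables (R : realType) (g : R).
Hypothesis g_gt0 : 0 < g.
Implicit Types h : R.

(** The speed of gravity waves; at rest it is the modulus of both
    eigenvalues of the Jacobian. *)
Definition celerity h := Num.sqrt (g * h).

Lemma celerity_gt0 h : 0 < h -> 0 < celerity h.
Proof. by move=> h0; rewrite sqrtr_gt0 mulr_gt0. Qed.

Lemma sqr_celerity h : 0 < h -> celerity h ^+ 2 = g * h.
Proof. by move=> h0; rewrite sqr_sqrtr// mulr_ge0// ltW. Qed.

Lemma height_vec2 h q : height (vec2 h q) = h.
Proof. by rewrite /height mxE. Qed.

Lemma flow_vec2 h q : flow (vec2 h q) = q.
Proof. by rewrite /flow mxE. Qed.

Lemma mean_rest hl hr :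
  mean (vec2 hl 0) (vec2 hr 0) = vec2 ((hl + hr) / 2) 0 :> 'cV[R]_2.
Proof. by rewrite /mean add_vec2 scale_vec2 addr0 mulr0 mulrC. Qed.

Lemma flux_rest h : flux g (vec2 h 0) = vec2 0 (2^-1 * g * h ^+ 2).
Proof. by rewrite /flux height_vec2 flow_vec2 expr0n mul0r add0r. Qed.

Lemma jacobian_rest h : jacobian_flux g (vec2 h 0) = mat2 0 1 (g * h) 0.
Proof.
by rewrite /jacobian_flux height_vec2 flow_vec2 expr0n mulr0 !mul0r oppr0 add0r.
Qed.

Lemma jacobian_rest_unit h : 0 < h -> jacobian_flux g (vec2 h 0) \in unitmx.
Proof.
move=> h0; rewrite jacobian_rest unitmxE det_mat2 unitfE mul0r sub0r mul1r.
by rewrite oppr_eq0 mulf_neq0// gt_eqF.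
Qed.

(** The eigenvalues are opposite, so |Lambda| is scalar and commutes with the
    matrix of eigenvectors. *)
Lemma abs_jacobian_rest h : 0 < h ->
  abs_jacobian g (vec2 h 0) = (celerity h)%:M.
Proof.
move=> /celerity_gt0 c0.
have l1 : lambda1 g (vec2 h 0) = celerity h.
  by rewrite /lambda1 flow_vec2 height_vec2 mul0r add0r.
have l2 : lambda2 g (vec2 h 0) = - celerity h.
  by rewrite /lambda2 flow_vec2 height_vec2 mul0r sub0r.
rewrite /abs_jacobian /eigenvectors l1 l2 normrN gtr0_norm// -scalar_mat2.
rewrite scalar_mxC -mulmxA mulmxV ?mulmx1// unitmxE det_mat2 unitfE.
by apply: ltr0_neq0; lra.
Qed.

(** |A| A^-1 is the matrix sign of A.  Both [D_left] and [D_right] are built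
    on it; it is off-diagonal at rest, which is how the source leaks into the
    height equation. *)
Lemma abs_sign_rest h : 0 < h ->
  abs_jacobian g (vec2 h 0) *m invmx (jacobian_flux g (vec2 h 0)) =
  mat2 0 (celerity h)^-1 (celerity h) 0.
Proof.
move=> h0; have c0 := gt_eqF (celerity_gt0 h0).
rewrite abs_jacobian_rest// jacobian_rest -sqr_celerity//.
rewrite invmx_mat2_adiag ?oner_neq0 ?expf_neq0 ?c0//.
rewrite scalar_mat2 mul_mat2 !mul0r !mulr0 !addr0 add0r invr1 mulr1.
by congr mat2; field; rewrite c0.
Qed.

Lemma numerical_flux_rest hl hr : 0 < hl -> 0 < hr ->
  numerical_flux g (vec2 hl 0) (vec2 hr 0) =
  vec2 (- (celerity ((hl + hr) / 2) * (hr - hl) / 2))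
       (g * (hl ^+ 2 + hr ^+ 2) / 4).
Proof.
move=> hl0 hr0; rewrite /numerical_flux !flux_rest mean_rest abs_jacobian_rest.
  rewrite /mean scalar_mat2 opp_vec2.
  rewrite !(add_vec2, mul_mat2_vec2, scale_vec2, opp_vec2).
  by congr vec2; field.
by lra.
Qed.

(** With c^2 = g h, the matrix sign turns the second entry - c^2 db of the
    source into a first entry - c db, of the same form as the viscosity in
    [numerical_flux_rest]. *)
Lemma left_source_rest h db : 0 < h ->
  D_left g (vec2 h 0) *m source g h db =
  - vec2 (celerity h * db) (celerity h ^+ 2 * db).
Proof.
move=> h0; have c0 := gt_eqF (celerity_gt0 h0).
rewrite /D_left abs_sign_rest// scalar_mat2 add_mat2.
rewrite /source mul_mat2_vec2 -sqr_celerity// opp_vec2.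
by congr vec2; field; rewrite ?c0.
Qed.

Lemma right_source_rest h db : 0 < h ->
  D_right g (vec2 h 0) *m source g h db =
  vec2 (celerity h * db) (- (celerity h ^+ 2 * db)).
Proof.
move=> h0; have c0 := gt_eqF (celerity_gt0 h0).
rewrite /D_right abs_sign_rest// scalar_mat2 opp_mat2 add_mat2.
rewrite /source mul_mat2_vec2 -sqr_celerity//.
by congr vec2; field; rewrite ?c0.
Qed.

(** The slopes of the bottom are written here as (hl - h) / dx and
    (h - hr) / dx, their values when the free surface is flat.  The two
    celerities stay symbolic in the height entry, where they cancel interface
    by interface; in the flow entry their squares become g times the mean
    heights, which leaves a difference of squares. *)
Lemma rest_balance (hl h hr dx dt : R) : 0 < hl -> 0 < h -> 0 < hr -> dx != 0 ->
  let What := vec2 h 0 - (dt / dx) *: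
    (numerical_flux g (vec2 h 0) (vec2 hr 0)
      - numerical_flux g (vec2 hl 0) (vec2 h 0)) in
  2^-1 *: (What + dt *: (D_left g (mean (vec2 h 0) (vec2 hl 0)) *m
                           source g ((h + hl) / 2) ((hl - h) / dx))
         + (What + dt *: (D_right g (mean (vec2 hr 0) (vec2 h 0)) *m
                           source g ((hr + h) / 2) ((h - hr) / dx))))
  = vec2 h 0.
Proof.
move=> hl0 h0 hr0 dx0 /=.
have ml0 : 0 < (h + hl) / 2 by lra.
have mr0 : 0 < (hr + h) / 2 by lra.
rewrite !mean_rest left_source_rest// right_source_rest// !numerical_flux_rest//.
rewrite (addrC hl) (addrC h hr) !sqr_celerity//.
rewrite !(opp_vec2, scale_vec2, add_vec2).
by congr vec2; field.
Qed.

Lemma Qtra2_rest (H b : R -> R) (A : R) (x : int -> R) dx t0 t1 W' :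
  (forall y, 0 < H y) -> (forall y, b y + H y = A) -> 0 < dx -> t0 < t1 ->
  Qtra2 g b x dx t0 t1 (fun j => vec2 (H (x j)) 0) W' <->
  forall j, W' j = vec2 (H (x j)) 0.
Proof.
move=> H0 bH dx0 t01.
have db y z : b y - b z = H z - H y by have := bH y; have := bH z; lra.
have balance j := rest_balance (t1 - t0) (H0 (x (j - 1))) (H0 (x j))
  (H0 (x (j + 1))) (lt0r_neq0 dx0).
split=> [[_ _ step] j|W'E].
  have [WL [WR []]] := step j.
  rewrite /homogeneous_step !ode_stepE// !height_vec2 !db.
  by move=> -> -> ->; exact: balance.
split=> [j|j|j]; first by rewrite height_vec2.
  by rewrite mean_rest; apply: jacobian_rest_unit; rewrite divr_gt0 ?addr_gt0.
eexists; eexists; split; [exact/ode_stepE..|].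
by rewrite W'E /homogeneous_step !height_vec2 !db; apply/esym/balance.
Qed.

End AtRest.

Theorem proposition2 (R : realType) (g : R) (hg : 0 < g) :
  exact_C_property (Qtra2 g).
Proof.
move=> b W [H [A [H0 bH WE]]] x dx dx0 _ t0 t1 t01 Wn Wn1 WnE.
have -> : Wn = fun j => vec2 (H (x j)) 0.
  by apply/funext => j; rewrite WnE WE.
have -> : (forall j, Wn1 j = W (x j) t1) = (forall j, Wn1 j = vec2 (H (x j)) 0).
  by congr (forall j, _); apply/funext => j; rewrite WE.
exact: Qtra2_rest bH dx0 t01.
Qed.
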